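(* Let $\gamma>0$ and $\alpha,\beta>\gamma$ be real numbers. Then the function $B_{(\alpha,\beta,\gamma)}:\mathbb{D}^2\times\mathbb{D}^2\to\mathbb{C}$ defined by $$B_{(\alpha,\beta,\gamma)}\big((z_1,z_2),(w_1,w_2)\big)=(1-z_1\overline{w}_1)^{-\alpha}(1-z_2\overline{w}_2)^{-\beta}(1-z_1\overline{w}_2)^{\gamma}(1-z_2\overline{w}_1)^{\gamma}$$ is non-negative definite.
   Context: $\mathbb{D}$ is the open unit disc in $\mathbb{C}$; powers of $1-z\bar w$ ($z,w\in\mathbb{D}$) are taken with the principal branch. A function $K:\Omega\times\Omega\to\mathbb{C}$ is non-negative definite if $\sum_{i,j=1}^p K(w_i,w_j)\zeta_j\overline{\zeta_i}\ge 0$ for all $p\in\mathbb{N}$, $w_1,\dots,w_p\in\Omega$ and $\zeta_1,\dots,\zeta_p\in\mathbb{C}$. *)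

(* Defs.v *)
From HB Require Import structures.
From mathcomp Require Import all_boot all_order all_algebra.
From mathcomp Require Import all_classical all_reals all_analysis.
From mathcomp Require Import complex.

Set Implicit Arguments.
Unset Strict Implicit.
Unset Printing Implicit Defensive.

Import Order.TTheory GRing.Theory Num.Theory.

Local Open Scope classical_set_scope.
Local Open Scope ring_scope.
Local Open Scope complex_scope.

Definition cexp (R : realType) (z : R[i]) : R[i] :=
  (expR (complex.Re z) * cos (complex.Im z))
    +i* (expR (complex.Re z) * sin (complex.Im z)).

(* Principal argument of z != 0, with values in ]-pi, pi]: see carg_itv and
   cexp_clog below. *)
Definition carg (R : realType) (z : R[i]) : R :=
  let t := acos (complex.Re z / ComplexField.Normc.normc z) in
  if 0 <= complex.Im z then t else - t.

Definition clog (R : realType) (z : R[i]) : R[i] :=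
  ln (ComplexField.Normc.normc z) +i* carg z.

(* Principal branch of z ^ a, for z != 0; the value at z = 0 is junk. *)
Definition cpow (R : realType) (z : R[i]) (a : R) : R[i] :=
  cexp (a%:C * clog z).

Definition unit_disc (R : realType) : set R[i] := [set z | `|z| < 1].

Definition bidisc (R : realType) : set (R[i] * R[i]) :=
  @unit_disc R `*` @unit_disc R.

(* The order of R[i] satisfies 0 <= x iff x is real and nonnegative. *)
Definition nonneg_definite (R : realType) (T : Type) (Omega : set T)
    (K : T -> T -> R[i]) : Prop :=
  forall (p : nat) (w : 'I_p -> T) (zeta : 'I_p -> R[i]),
    (forall i, Omega (w i)) ->
    0 <= \sum_(i < p) \sum_(j < p) K (w i) (w j) * zeta j * (zeta i)^*.

Definition B_kernel (R : realType) (alpha beta gamma : R)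
    (z w : R[i] * R[i]) : R[i] :=
  cpow (1 - z.1 * w.1^*) (- alpha) * cpow (1 - z.2 * w.2^*) (- beta)
  * cpow (1 - z.1 * w.2^*) gamma * cpow (1 - z.2 * w.1^*) gamma.

Section PrincipalLog.
Variables (R : realType) (z : R[i]).
Hypothesis z_neq0 : z != 0.

Let r := ComplexField.Normc.normc z.

Let r_gt0 : 0 < r.
Proof.
rewrite lt_def; apply/andP; split.
  by apply: contra z_neq0 => /eqP /ComplexField.Normc.eq0_normc ->.
by rewrite /r; case: (z) => a b; exact: sqrtr_ge0.
Qed.

Let r2E : r ^+ 2 = complex.Re z ^+ 2 + complex.Im z ^+ 2.
Proof.
by rewrite /r; case: (z) => a b /=; rewrite sqr_sqrtr // addr_ge0 ?sqr_ge0.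
Qed.

Let ratio_bound : -1 <= complex.Re z / r <= 1.
Proof.
rewrite -ler_norml normrM normfV (gtr0_norm r_gt0) ler_pdivrMr // mul1r.
rewrite -(ler_pXn2r (n := 2)) ?nnegrE ?normr_ge0 ?(ltW r_gt0) //.
by rewrite real_normK ?num_real // r2E lerDl sqr_ge0.
Qed.

Let sin_acos_ratio : r * sin (acos (complex.Re z / r)) = `|complex.Im z|.
Proof.
rewrite sin_acos // -[X in X * _](gtr0_norm r_gt0) -sqrtr_sqr -sqrtrM ?sqr_ge0 //.
rewrite -[RHS]sqrtr_sqr; congr Num.sqrt.
rewrite mulrBr mulr1 -exprMn mulrC divfK ?gt_eqF // r2E.
by rewrite addrC addKr.
Qed.

Lemma carg_itv : - pi < carg z <= pi.
Proof.
have t0 := acos_ge0 ratio_bound; have tpi := acos_lepi ratio_bound.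
have pi0 := pi_gt0 R.
rewrite /carg -/r; case: ifPn => [_|Imz].
  by rewrite tpi andbT (lt_le_trans _ t0) // oppr_lt0.
rewrite ltrN2 (le_trans _ (ltW pi0)) ?oppr_le0 // andbT lt_neqAle tpi andbT.
apply: contraNneq Imz => tE; move: sin_acos_ratio.
by rewrite tE sinpi mulr0 => /esym/eqP; rewrite normr_eq0 => /eqP ->.
Qed.

Lemma cexp_clog : cexp (clog z) = z.
Proof.
rewrite /cexp /clog /= -/r lnK ?posrE //.
have cosE : r * cos (carg z) = complex.Re z.
  rewrite /carg -/r; case: ifP => _; rewrite ?cosN acosK ?in_itv //= mulrC;
  by rewrite divfK ?gt_eqF.
have sinE : r * sin (carg z) = complex.Im z.
  rewrite /carg -/r; case: ifPn => Imz; rewrite ?sinN ?mulrN sin_acos_ratio.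
    by rewrite ger0_norm.
  by rewrite ltr0_norm ?opprK // ltNge.
by rewrite cosE sinE; case: (z).
Qed.

End PrincipalLog.

(* Main.v *)
(** Since [- log (1 - u)] is the sum of the [u ^ n / n], the kernel is the
    exponential of the sum over [n >= 1] of [1 / n] times
      [(alpha - gamma) z1^n conj(w1)^n + (beta - gamma) z2^n conj(w2)^n
       + gamma (z1^n - z2^n) conj(w1^n - w2^n)],
    a limit of nonnegative combinations of kernels [f z * conj (f w)].  Such
    combinations are closed under products, so the Taylor polynomials of [exp]
    preserve them, and nonnegative definiteness survives pointwise limits. *)
Require Import Defs.
From mathcomp Require Import all_boot all_order all_algebra.
From mathcomp Require Import all_classical all_reals all_analysis.
From mathcomp Require Import complex.
From mathcomp Require Import ring lra.

Set Implicit Arguments.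
Unset Strict Implicit.
Unset Printing Implicit Defensive.

Import Order.TTheory GRing.Theory Num.Theory.
Import numFieldNormedType.Exports.
Import ComplexField.Normc.

Local Open Scope classical_set_scope.
Local Open Scope ring_scope.

Local Notation Re := complex.Re.
Local Notation Im := complex.Im.
Local Notation "x %:C" := (real_complex _ x) : ring_scope.

(** * Kernels with an explicit finite factorization *)

Section SumsOfSquares.
Variables (R : realType) (T : Type).
Implicit Types K L : T -> T -> R[i].

(** Carrying the factors in a list turns closure under sums and products into concatenation and
    pairwise multiplication. *)
Definition sos K :=
  exists s : seq (T -> R[i]), forall z w, K z w = \sum_(f <- s) f z * (f w)^*.

Lemma eq_sos K L : (forall z w, K z w = L z w) -> sos L -> sos K.
Proof. by move=> KL [s sE]; exists s => z w; rewrite KL sE. Qed.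

Lemma sos_square (f : T -> R[i]) : sos (fun z w => f z * (f w)^*).
Proof. by exists [:: f] => z w; rewrite big_seq1. Qed.

Lemma sosD K L : sos K -> sos L -> sos (fun z w => K z w + L z w).
Proof.
by move=> [s sE] [t tE]; exists (s ++ t) => z w; rewrite big_cat sE tE.
Qed.

(** The square kernels of [f] and [g] multiply to that of [f * g]: this is the Schur product theorem
    for factored kernels. *)
Lemma sosM K L : sos K -> sos L -> sos (fun z w => K z w * L z w).
Proof.
move=> [s sE] [t tE].
exists [seq (fun z => f z * g z) | f <- s, g <- t] => z w.
rewrite sE tE big_allpairs_dep mulr_suml; apply: eq_bigr => f _.
by rewrite mulr_sumr; apply: eq_bigr => g _; rewrite rmorphM mulrACA.
Qed.

Lemma sos_cst (c : R) : 0 <= c -> sos (fun _ _ => c%:C).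
Proof.
move=> c0; apply: eq_sos (sos_square (fun=> (Num.sqrt c)%:C)) => z w.
by rewrite conj_Creal ?complex_real // -rmorphM /= -expr2 sqr_sqrtr.
Qed.

Lemma sosZ (c : R) K : 0 <= c -> sos K -> sos (fun z w => c%:C * K z w).
Proof. by move=> c0; apply/sosM/sos_cst. Qed.

Lemma sos_sum (K : nat -> T -> T -> R[i]) n :
  (forall k, sos (K k)) -> sos (fun z w => \sum_(k < n) K k z w).
Proof.
move=> Kk; elim: n => [|n IH].
  by exists [::] => z w; rewrite big_ord0 big_nil.
by apply: eq_sos (sosD IH (Kk n)) => z w; rewrite big_ord_recr.
Qed.

Lemma sosX K n : sos K -> sos (fun z w => K z w ^+ n).
Proof.
move=> sK; elim: n => [|n IH].
  by apply: eq_sos (sos_cst ler01) => z w; rewrite expr0.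
by apply: eq_sos (sosM sK IH) => z w; rewrite exprS.
Qed.

(** Once the sums are exchanged, each factor [f] contributes [X * X^*], where [X] is the sum of the
    [f (w i) * (zeta i)^*]. *)
Lemma sos_nonneg_definite (Omega : set T) K : sos K -> nonneg_definite Omega K.
Proof.
move=> [s sE] p w zeta _.
suff -> : \sum_(i < p) \sum_(j < p) K (w i) (w j) * zeta j * (zeta i)^* =
    \sum_(f <- s) `|\sum_(i < p) f (w i) * (zeta i)^*| ^+ 2.
  by apply: sumr_ge0 => f _; rewrite exprn_ge0.
under eq_bigr do under eq_bigr do rewrite sE -mulrA mulr_suml.
under eq_bigr do rewrite exchange_big.
rewrite exchange_big; apply: eq_bigr => f _.
rewrite normCK rmorph_sum mulr_suml; apply: eq_bigr => i _.
rewrite mulr_sumr; apply: eq_bigr => j _.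
by rewrite rmorphM /= conjCK; ring.
Qed.

End SumsOfSquares.

(** * Coordinatewise limits of complex sequences and kernels *)

Section ComplexLimits.
Variable R : realType.
Implicit Types (z w : R[i]) (u v : nat -> R[i]).

Lemma ReD z w : Re (z + w) = Re z + Re w. Proof. by case: z w => [a b] []. Qed.
Lemma ImD z w : Im (z + w) = Im z + Im w. Proof. by case: z w => [a b] []. Qed.
Lemma ReN z : Re (- z) = - Re z. Proof. by case: z. Qed.
Lemma ImN z : Im (- z) = - Im z. Proof. by case: z. Qed.
Lemma ReM z w : Re (z * w) = Re z * Re w - Im z * Im w.
Proof. by case: z w => [a b] []. Qed.
Lemma ImM z w : Im (z * w) = Re z * Im w + Im z * Re w.
Proof. by case: z w => [a b] []. Qed.
Definition ReImE := (ReD, ImD, ReN, ImN, ReM, ImM).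

(** Splitting into coordinates gives access to real limits and, later, to the real mean value
    theorem. *)
Definition cconv u z :=
  ((fun n => Re (u n)) @ \oo --> Re z) /\ ((fun n => Im (u n)) @ \oo --> Im z).

Lemma cconv_cst z : cconv (fun=> z) z.
Proof. by split; exact: cvg_cst. Qed.

Lemma cconvD u v z w :
  cconv u z -> cconv v w -> cconv (fun n => u n + v n) (z + w).
Proof.
move=> [u1 u2] [v1 v2]; split.
  by under eq_fun do rewrite ReD; rewrite ReD; exact: cvgD.
by under eq_fun do rewrite ImD; rewrite ImD; exact: cvgD.
Qed.

Lemma cconvM u v z w :
  cconv u z -> cconv v w -> cconv (fun n => u n * v n) (z * w).
Proof.
move=> [u1 u2] [v1 v2]; split.
  by under eq_fun do rewrite ReM; rewrite ReM; apply: cvgB; exact: cvgM.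
by under eq_fun do rewrite ImM; rewrite ImM; apply: cvgD; exact: cvgM.
Qed.

Lemma cconvZ u z c : cconv u z -> cconv (fun n => c * u n) (c * z).
Proof. by apply/cconvM/cconv_cst. Qed.

Lemma cconv_sum p (u : 'I_p -> nat -> R[i]) (z : 'I_p -> R[i]) :
  (forall i, cconv (u i) (z i)) ->
  cconv (fun n => \sum_(i < p) u i n) (\sum_(i < p) z i).
Proof.
elim: p u z => [|p IH] u z uz.
  rewrite big_ord0; under [X in cconv X]eq_fun do rewrite big_ord0.
  exact: cconv_cst.
rewrite big_ord_recr; under [X in cconv X]eq_fun do rewrite big_ord_recr.
by apply: cconvD (uz _); exact: IH.
Qed.

Lemma cconvX u z k : cconv u z -> cconv (fun n => u n ^+ k) (z ^+ k).
Proof.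
move=> uz; elim: k => [|k IH]; first exact: cconv_cst.
rewrite exprS; under [X in cconv X]eq_fun do rewrite exprS.
exact: cconvM.
Qed.

(** Nonnegativity in [R[i]] includes a zero imaginary part, so the imaginary parts are constantly 0,
    while the real parts keep their sign in the limit. *)
Lemma cconv_ge0 u z : cconv u z -> (forall n, 0 <= u n) -> 0 <= z.
Proof.
move=> [uz1 uz2] u0; rewrite lecE /=; apply/andP; split.
  rewrite -(cvg_lim _ uz2) //; apply/eqP.
  under eq_fun do rewrite ger0_Im //.
  exact: lim_cst.
have := cvg_lim _ uz1; move=> <- //; apply: limr_ge.
  by apply/cvg_ex; exists (Re z).
by apply: nearW => n; have := u0 n; rewrite lecE => /andP[].
Qed.

(** For fixed points and coefficients the Hermitian form is a finite sum, so pointwise convergence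
    on [Omega] is enough. *)
Lemma nonneg_definite_lim T (Omega : set T) (K_ : nat -> T -> T -> R[i])
    (K : T -> T -> R[i]) :
    (forall n, nonneg_definite Omega (K_ n)) ->
    (forall x y, Omega x -> Omega y -> cconv (fun n => K_ n x y) (K x y)) ->
  nonneg_definite Omega K.
Proof.
move=> K_ge0 KK p w zeta Ow.
apply: (@cconv_ge0
  (fun n => \sum_(i < p) \sum_(j < p) K_ n (w i) (w j) * zeta j * (zeta i)^*)).
  apply: cconv_sum => i; apply: cconv_sum => j.
  by do 2!(apply: cconvM; last exact: cconv_cst); exact: KK.
by move=> n; exact: K_ge0.
Qed.

Lemma normc_ge0 z : 0 <= normc z.
Proof. by case: z => a b; exact: sqrtr_ge0. Qed.

Lemma sqr_normc_ReIm z : normc z ^+ 2 = Re z ^+ 2 + Im z ^+ 2.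
Proof. by case: z => a b /=; rewrite sqr_sqrtr // addr_ge0 ?sqr_ge0. Qed.

Lemma normr_Re_le z : `|Re z| <= normc z.
Proof.
rewrite -(ler_pXn2r (n := 2)) ?nnegrE ?normc_ge0 //.
by rewrite real_normK ?num_real // sqr_normc_ReIm lerDl sqr_ge0.
Qed.

Lemma normr_Im_le z : `|Im z| <= normc z.
Proof.
rewrite -(ler_pXn2r (n := 2)) ?nnegrE ?normc_ge0 //.
by rewrite real_normK ?num_real // sqr_normc_ReIm lerDr sqr_ge0.
Qed.

Lemma normcX z n : normc (z ^+ n) = normc z ^+ n.
Proof. by elim: n => [|n IH]; rewrite ?normc1 // !exprS normcM IH. Qed.

Lemma normc_real (x : R) : normc x%:C = `|x|.
Proof. by rewrite /= expr0n addr0 sqrtr_sqr. Qed.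

Lemma normr_normc z : `|z| = (normc z)%:C.
Proof. by rewrite normc_def; case: z. Qed.

Lemma cconv_bound u z (e : nat -> R) :
    (forall n, `|Re (u n - z)| <= e n) -> (forall n, `|Im (u n - z)| <= e n) ->
  e @ \oo --> 0 -> cconv u z.
Proof.
have sq (f : nat -> R) l : (forall n, `|f n - l| <= e n) ->
    e @ \oo --> 0 -> f @ \oo --> l.
  move=> fe e0; apply/cvgrPdist_le => eps eps0.
  near=> n; rewrite distrC (le_trans (fe n)) //.
  by near: n; apply: (cvgr_le _ e0).
move=> ue1 ue2 e0; split; apply: sq => // n.
  by rewrite -ReN -ReD.
by rewrite -ImN -ImD.
Unshelve. all: by end_near. Qed.

End ComplexLimits.

(** * Complex-valued functions of a real variable, and the principal logarithm *)

Section ComplexDerivatives.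
Variable R : realType.
Implicit Types (z w D E : R[i]) (F G : R -> R[i]) (x : R).

Definition cderive F x D :=
  is_derive x 1 (fun t => Re (F t)) (Re D) /\
  is_derive x 1 (fun t => Im (F t)) (Im D).

(** Lets the calculus rules produce a derivative in raw form, to be matched with the wanted one by
    [ring] or [field]. *)
Lemma is_derive_val (f : R -> R) x a b :
  is_derive x 1 f a -> a = b -> is_derive x 1 f b.
Proof. by move=> ? <-. Qed.

Lemma is_derive_fun_comp (h f : R -> R) x a b : is_derive (f x) 1 h a ->
  is_derive x 1 f b -> is_derive x 1 (fun t => h (f t)) (a * b).
Proof. by move=> ha fb; exact: (is_derive1_comp ha fb). Qed.

Lemma is_derive_fun_add (f g : R -> R) x a b : is_derive x 1 f a ->
  is_derive x 1 g b -> is_derive x 1 (fun t => f t + g t) (a + b).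
Proof. exact: (@is_deriveD _ _ _ f g x 1 a b). Qed.

Lemma is_derive_fun_sub (f g : R -> R) x a b : is_derive x 1 f a ->
  is_derive x 1 g b -> is_derive x 1 (fun t => f t - g t) (a - b).
Proof. exact: (@is_deriveB _ _ _ f g x 1 a b). Qed.

Lemma is_derive_fun_mul (f g : R -> R) x a b : is_derive x 1 f a ->
  is_derive x 1 g b -> is_derive x 1 (fun t => f t * g t) (a * g x + f x * b).
Proof.
by move=> fa gb; rewrite addrC (mulrC a); exact: is_deriveM.
Qed.

Lemma cderive_cst z x : cderive (fun=> z) x 0.
Proof. by split; exact: is_derive_cst. Qed.

Lemma cderive_real x : cderive (fun t => t%:C) x 1.
Proof. by split; [exact: is_derive_id|exact: is_derive_cst]. Qed.

Lemma cderiveD F G x D E :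
  cderive F x D -> cderive G x E -> cderive (fun t => F t + G t) x (D + E).
Proof.
move=> [F1 F2] [G1 G2]; split.
  by under eq_fun do rewrite ReD; rewrite ReD; exact: is_derive_fun_add.
by under eq_fun do rewrite ImD; rewrite ImD; exact: is_derive_fun_add.
Qed.

Lemma cderiveM F G x D E : cderive F x D -> cderive G x E ->
  cderive (fun t => F t * G t) x (D * G x + F x * E).
Proof.
move=> [F1 F2] [G1 G2]; split.
  under eq_fun do rewrite ReM.
  apply: is_derive_val (is_derive_fun_sub (is_derive_fun_mul F1 G1)
    (is_derive_fun_mul F2 G2)) _.
  by rewrite !ReImE; ring.
under eq_fun do rewrite ImM.
apply: is_derive_val (is_derive_fun_add (is_derive_fun_mul F1 G2)
  (is_derive_fun_mul F2 G1)) _.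
by rewrite !ReImE; ring.
Qed.

Lemma cderiveZ z F x D : cderive F x D -> cderive (fun t => z * F t) x (z * D).
Proof.
by move=> FD; have := cderiveM (cderive_cst z x) FD; rewrite mul0r add0r.
Qed.

Lemma cderiveX F x D n : cderive F x D ->
  cderive (fun t => F t ^+ n.+1) x (n.+1%:R * F x ^+ n * D).
Proof.
move=> FD; elim: n => [|n IH]; first by rewrite expr0 mul1r mul1r.
under [X in cderive X]eq_fun do rewrite exprS.
have := cderiveM FD IH; congr (cderive _ _ _).
by rewrite -[in RHS]natr1 exprS; ring.
Qed.

Lemma cderive_sum (F : nat -> R -> R[i]) x (D : nat -> R[i]) n :
    (forall k, cderive (F k) x (D k)) ->
  cderive (fun t => \sum_(k < n) F k t) x (\sum_(k < n) D k).
Proof.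
move=> FD; elim: n => [|n IH].
  under [X in cderive X]eq_fun do rewrite big_ord0.
  by rewrite big_ord0; exact: cderive_cst.
under [X in cderive X]eq_fun do rewrite big_ord_recr.
by rewrite big_ord_recr; exact: cderiveD.
Qed.

Lemma cderive_exp F x D :
  cderive F x D -> cderive (fun t => cexp (F t)) x (D * cexp (F x)).
Proof.
move=> [F1 F2]; have E1 := is_derive_fun_comp (is_derive_expR _) F1.
split; rewrite /cexp /=.
  apply: is_derive_val
    (is_derive_fun_mul E1 (is_derive_fun_comp (is_derive_cos _) F2)) _.
  by rewrite ReM /=; ring.
apply: is_derive_val
  (is_derive_fun_mul E1 (is_derive_fun_comp (is_derive_sin _) F2)) _.
by rewrite ImM /=; ring.
Qed.

(* On the right half-plane the principal logarithm has this globally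
   differentiable expression. *)
Lemma clog_right_half_plane z : 0 < Re z ->
  clog z =
    Complex (ln (Re z * Re z + Im z * Im z) / 2) (atan (Im z / Re z)).
Proof.
move=> z0; have n0 : 0 < normc z.
  by rewrite (lt_le_trans _ (normr_Re_le z)) // normr_gt0 gt_eqF.
rewrite /clog -!expr2 -sqr_normc_ReIm lnXn // -[_ *+ 2]mulr_natr mulfK //.
congr Complex.
(* [carg] applies [acos] to this cosine; since [t] has the sign of [Im z], the case split in [carg]
   picks [t] both times. *)
set t := atan _; have tE : Re z / normc z = cos t.
  rewrite cos_atan; have -> : 1 + (Im z / Re z) ^+ 2 = (normc z / Re z) ^+ 2.
    by rewrite !expr_div_n sqr_normc_ReIm; field; rewrite gt_eqF.
  by rewrite sqrtr_sqr ger0_norm ?divr_ge0 ?normc_ge0 ?ltW // invf_div.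
have t1 := atan_ltpi2 (Im z / Re z); have t2 := atan_gtNpi2 (Im z / Re z).
have pi0 := pi_gt0 R; rewrite -/t in t1 t2.
rewrite /carg tE; case: ifPn => [Im0|].
  have t0 : 0 <= t.
    by rewrite -[leLHS](@atan0 R) le_atan // divr_ge0 // ltW.
  by rewrite cosK // in_itv /=; apply/andP; split; lra.
rewrite -ltNge => Im0; have t0 : t <= 0.
  by rewrite -[leRHS](@atan0 R) le_atan // pmulr_lle0 ?invr_gt0 // ltW.
by rewrite cosKN ?opprK //; apply/andP; split; lra.
Qed.

Lemma cderive_log F x D : 0 < Re (F x) -> cderive F x D ->
  cderive (fun t => Complex (ln (Re (F t) * Re (F t) + Im (F t) * Im (F t)) / 2)
                            (atan (Im (F t) / Re (F t)))) x (D / F x).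
Proof.
move=> F0; set E := D / F x => -[F1 F2].
(* Trading [D] for [E * F x] keeps the complex quotient out of the coordinates: the denominators
   left are real, namely [Re (F x)] and the squared modulus. *)
have DE : D = E * F x.
  by rewrite divfK //; apply: contraTneq F0 => ->; rewrite ltxx.
clearbody E; have n0 : 0 < Re (F x) * Re (F x) + Im (F x) * Im (F x).
  by rewrite -!expr2 ltr_pwDl ?exprn_gt0 ?sqr_ge0.
split=> /=.
  have L := @is_derive_fun_comp (@ln R)
    (fun t => Re (F t) * Re (F t) + Im (F t) * Im (F t)) _ _ _ (is_derive1_ln n0)
    (is_derive_fun_add (is_derive_fun_mul F1 F1) (is_derive_fun_mul F2 F2)).
  apply: is_derive_val (is_derive_fun_mul L (is_derive_cst (2^-1 : R) x 1)) _.
  by rewrite DE !ReImE /cst; field; rewrite gt_eqF.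
have F0' : Re (F x) != 0 by rewrite gt_eqF.
apply: is_derive_val (@is_derive_fun_comp (@atan R)
  (fun t => Im (F t) / Re (F t)) _ _ _ (is_derive1_atan _)
  (is_derive_fun_mul F2 (is_deriveV F0' F1))) _.
rewrite DE !ReImE /GRing.scale /=; field.
by rewrite !expr2 !gt_eqF.
Qed.

(** The mean value theorem has no complex-valued form, so each coordinate gets its own intermediate
    point; [C] bounds both coordinates of the derivative. *)
Lemma cderive_MVT F (D : R -> R[i]) (C : R) :
    (forall t : R, 0 <= t <= 1 -> cderive F t (D t)) ->
    (forall t : R, 0 <= t <= 1 -> normc (D t) <= C) ->
  `|Re (F 1 - F 0)| <= C /\ `|Im (F 1 - F 0)| <= C.
Proof.
have aux (f d : R -> R) : (forall t : R, 0 <= t <= 1 -> is_derive t 1 f (d t)) ->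
    (forall t : R, 0 <= t <= 1 -> `|d t| <= C) -> `|f 1 - f 0| <= C.
  move=> fd dC.
  have fd' (t : R) : t \in `]0, 1[%R -> is_derive t 1 f (d t).
    by rewrite in_itv /= => /andP[t0 t1]; apply: fd; rewrite !ltW.
  have cf : {within `[0, 1], continuous f}.
    apply: derivable_within_continuous => t; rewrite in_itv => t01.
    exact: (@ex_derive _ _ _ _ _ _ _ (fd _ t01)).
  have [c] := MVT ltr01 fd' cf.
  by rewrite in_itv subr0 mulr1 => /andP[c0 c1] ->; rewrite dC // !ltW.
move=> FD DC; rewrite !ReImE; split.
  apply: (aux (fun t => Re (F t)) (fun t => Re (D t))) => t t01.
    by case: (FD t t01).
  exact: le_trans (normr_Re_le _) (DC _ t01).
apply: (aux (fun t => Im (F t)) (fun t => Im (D t))) => t t01.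
  by case: (FD t t01).
exact: le_trans (normr_Im_le _) (DC _ t01).
Qed.

End ComplexDerivatives.

(** * Power series of the principal logarithm and of the exponential *)

Section Series.
Variable R : realType.
Implicit Types z w u : R[i].

Lemma cexpD z w : cexp (z + w) = cexp z * cexp w.
Proof.
apply/eqP; rewrite eq_complex !ReImE /cexp /= !ReImE expRD sinD cosD.
by apply/andP; split; apply/eqP; ring.
Qed.

Lemma cexp0 : cexp 0 = 1 :> R[i].
Proof. by rewrite /cexp /= expR0 cos0 sin0 mulr1 mulr0. Qed.

Lemma normc_cexp z : normc (cexp z) = expR (Re z).
Proof.
rewrite /cexp /= !exprMn -mulrDr cos2Dsin2 mulr1 sqrtr_sqr.
by rewrite ger0_norm // expR_ge0.
Qed.

Lemma geometric_sum u n : (1 - u) * (\sum_(k < n) u ^+ k) = 1 - u ^+ n.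
Proof. by rewrite -opprB mulNr -subrX1 opprB. Qed.

Definition log_partial u n := \sum_(k < n) (k.+1%:R^-1)%:C * u ^+ k.+1.

(** There are [n.+1] terms, so the degree is [n] and the constant term 1 is always present. *)
Definition exp_partial u n := \sum_(k < n.+1) (k`!%:R^-1)%:C * u ^+ k.

Lemma cderive_line u x : cderive (fun t : R => t%:C * u) x u.
Proof.
have := cderiveM (cderive_real x) (cderive_cst u x).
by rewrite mulr0 addr0 mul1r.
Qed.

(* The derivative of t |-> clog (1 - t u) + log_partial (t u) n is
   - u (t u)^n / (1 - t u), which is uniformly small on [0, 1]. *)
Lemma log_partial_cvg u : normc u < 1 -> cconv (log_partial u) (- clog (1 - u)).
Proof.
(* The bound comes from [normc (t u) <= normc u < 1] and [normc (1 - t u) >= 1 - normc u]. *)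
move=> u1; pose e n := normc u ^+ n / (1 - normc u).
have u1' : 0 < 1 - normc u by rewrite subr_gt0.
have tu t : 0 <= t <= 1 -> normc (t%:C * u) <= normc u.
  move=> /andP[t0 t1]; rewrite normcM normc_real ger0_norm //.
  by rewrite ler_piMl ?normc_ge0.
(* The segment from 1 to [1 - u] stays uniformly inside the right half-plane, which validates the
   formula for [clog] and bounds [1 / (1 - t u)]. *)
have Re_tu t : 0 <= t <= 1 -> 1 - normc u <= Re (1 - t%:C * u).
  move=> /tu t01; rewrite ReD ReN lerD2l lerN2.
  exact: le_trans (ler_norm _) (le_trans (normr_Re_le _) t01).
have Re_gt0 t : 0 <= t <= 1 -> 0 < Re (1 - t%:C * u).
  by move=> /Re_tu; exact: lt_le_trans.
pose L t := Complex (ln (Re (1 - t%:C * u) * Re (1 - t%:C * u) +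
  Im (1 - t%:C * u) * Im (1 - t%:C * u)) / 2)
  (atan (Im (1 - t%:C * u) / Re (1 - t%:C * u))).
have LE t : 0 <= t <= 1 -> L t = clog (1 - t%:C * u).
  by move=> /Re_gt0 ?; rewrite clog_right_half_plane.
pose F n t := L t + log_partial (t%:C * u) n.
have DF n t : 0 <= t <= 1 ->
    cderive (F n) t (- (u * (t%:C * u) ^+ n / (1 - t%:C * u))).
  move=> t01; have tu0 : 1 - t%:C * u != 0.
    by apply: contraTneq (Re_gt0 _ t01) => ->; rewrite ltxx.
  have D1 : cderive (fun s : R => 1 - s%:C * u) t (- u).
    have := cderiveD (cderive_cst 1 t) (cderiveZ (-1) (cderive_line u t)).
    rewrite add0r mulN1r; congr cderive.
    by apply/funext => s; rewrite mulN1r.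
  have D2 := cderive_sum n (fun k =>
    cderiveZ (k.+1%:R^-1)%:C (cderiveX k (cderive_line u t))).
  have := cderiveD (cderive_log (Re_gt0 _ t01) D1) D2; congr cderive.
  (* The differentiated polynomial is [u] times a geometric sum; its closed form cancels the
     derivative of the logarithm up to the [n]-th power. *)
  have -> : \sum_(k < n) (k.+1%:R^-1)%:C * (k.+1%:R * (t%:C * u) ^+ k * u) =
      u * \sum_(k < n) (t%:C * u) ^+ k.
    rewrite mulr_sumr; apply: eq_bigr => k _.
    rewrite fmorphV rmorph_nat !mulrA mulVf ?pnatr_eq0 // mul1r.
    exact: mulrC.
  apply: (mulfI tu0); rewrite mulrDr (mulrCA _ u) geometric_sum; field.
  exact: tu0.
have DFe n t : 0 <= t <= 1 ->
    normc (- (u * (t%:C * u) ^+ n / (1 - t%:C * u))) <= e n.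
  move=> t01; rewrite normcN !normcM normcX normcV /e.
  apply: ler_pM; rewrite ?invr_ge0 ?mulr_ge0 ?exprn_ge0 ?normc_ge0 //.
    rewrite -[leRHS]mul1r; apply: ler_pM; rewrite ?exprn_ge0 ?normc_ge0 //.
      exact: ltW.
    by apply: lerXn2r; rewrite ?nnegrE ?normc_ge0 //; exact: tu.
  rewrite lef_pV2 ?posrE //; last first.
    rewrite (lt_le_trans (Re_gt0 _ t01)) //.
    exact: le_trans (ler_norm _) (normr_Re_le _).
  apply: le_trans (Re_tu _ t01) _.
  exact: le_trans (ler_norm _) (normr_Re_le _).
have F10 n : F n 1 - F n 0 = log_partial u n - - clog (1 - u).
  rewrite /F !LE ?lexx ?ler01 // mul1r mul0r subr0 opprK.
  have -> : clog 1 = 0 :> R[i].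
    rewrite /clog /carg /= expr0n addr0 expr1n sqrtr1 ln1 divr1 acos1.
    by rewrite lexx.
  have -> : log_partial 0 n = 0.
    by rewrite /log_partial big1 // => k _; rewrite exprS mul0r mulr0.
  by rewrite addr0 subr0 addrC.
apply: (@cconv_bound _ _ _ e).
- by move=> n; rewrite -F10; case: (cderive_MVT (DF n) (DFe n)).
- by move=> n; rewrite -F10; case: (cderive_MVT (DF n) (DFe n)).
rewrite -[X in _ --> X](mul0r (1 - normc u)^-1).
apply: cvgM; last exact: cvg_cst.
by apply: cvg_expr; rewrite ger0_norm ?normc_ge0.
Qed.

(* The derivative of t |-> cexp (- t u) * exp_partial (t u) n is
   - u (t u)^n / n! * cexp (- t u), which is uniformly small on [0, 1]. *)
Lemma exp_partial_cvg u : cconv (exp_partial u) (cexp u).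
Proof.
(* Up to a factor free of [n], this is a term of the exponential series at [normc u], hence tends to
   0. *)
pose e n := normc u * expR (normc u) * exp_coeff (normc u) n.
pose F n t := cexp (t%:C * (- u)) * exp_partial (t%:C * u) n.
have DF n t : cderive (F n) t
    (- (u * (t%:C * u) ^+ n * (n`!%:R^-1)%:C * cexp (t%:C * (- u)))).
  have D1 := cderive_exp (cderive_line (- u) t).
  (* Differentiation drops the top term. The rest cancels against the derivative of
     [cexp (- t u)]. *)
  have D2 : cderive (fun s : R => exp_partial (s%:C * u) n) t
      (u * (exp_partial (t%:C * u) n - (n`!%:R^-1)%:C * (t%:C * u) ^+ n)).
    rewrite /exp_partial big_ord_recr /= addrK.
    (* The constant term is split off because [cderiveX] treats exponents of the form [k.+1]. *)
    under [X in cderive X]eq_fun do rewrite big_ord_recl.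
    have := cderiveD (cderive_cst ((0`!%:R^-1)%:C * 1) t)
      (cderive_sum n (fun k => cderiveZ (k.+1`!%:R^-1)%:C
        (cderiveX k (cderive_line u t)))).
    rewrite add0r mulr_sumr; congr cderive; apply: eq_bigr => k _.
    rewrite factS natrM !fmorphV rmorphM !rmorph_nat; field.
    by rewrite addrC natr1 !pnatr_eq0 -lt0n fact_gt0.
  by have := cderiveM D1 D2; congr cderive; rewrite /exp_partial; ring.
have DFe n t : 0 <= t <= 1 -> normc
    (- (u * (t%:C * u) ^+ n * (n`!%:R^-1)%:C * cexp (t%:C * (- u)))) <= e n.
  move=> /andP[t0 t1]; have tu : normc (t%:C * u) <= normc u.
    by rewrite normcM normc_real ger0_norm // ler_piMl ?normc_ge0.
  rewrite normcN !normcM normcX normc_cexp normc_real.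
  rewrite ger0_norm ?invr_ge0 // /e exp_coeffE.
  have -> : normc u * expR (normc u) * (n`!%:R^-1 * normc u ^+ n) =
    normc u * normc u ^+ n * n`!%:R^-1 * expR (normc u) by ring.
  apply: ler_pM; rewrite ?mulr_ge0 ?exprn_ge0 ?normc_ge0 ?expR_ge0 ?invr_ge0 //.
    apply: ler_wpM2r; rewrite ?invr_ge0 //; apply: ler_wpM2l => //.
      exact: normc_ge0.
    by apply: lerXn2r; rewrite ?nnegrE ?normc_ge0.
  rewrite ler_expR mulrN ReN (le_trans _ tu) // (le_trans _ (normr_Re_le _)) //.
  by rewrite -normrN ler_norm.
have F10 n : F n 1 - F n 0 = cexp (- u) * exp_partial u n - 1.
  rewrite /F !mul1r !mul0r cexp0 mul1r; congr (_ - _).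
  rewrite /exp_partial big_ord_recl big1 => [|k _].
    by rewrite addr0 fact0 invr1 mul1r.
  by rewrite exprS mul0r mulr0.
have : cconv (fun n => cexp (- u) * exp_partial u n) 1.
  apply: (@cconv_bound _ _ _ e).
  - by move=> n; rewrite -F10; case: (cderive_MVT (fun t _ => DF n t) (DFe n)).
  - by move=> n; rewrite -F10; case: (cderive_MVT (fun t _ => DF n t) (DFe n)).
  rewrite -[X in _ --> X](mulr0 (normc u * expR (normc u))).
  by apply: cvgM; [exact: cvg_cst|exact: cvg_exp_coeff].
move=> /(cconvZ (cexp u)); rewrite mulr1; congr cconv.
by apply/funext => n; rewrite mulrA -cexpD subrr cexp0 mul1r.
Qed.

End Series.

(** * The kernel as an exponential of a limit of sums of squares *)

Theorem proposition3p6 (R : realType) (alpha beta gamma : R)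
  (gamma_gt0 : 0 < gamma) (gamma_lt_alpha : gamma < alpha)
  (gamma_lt_beta : gamma < beta) :
  nonneg_definite (@bidisc R) (B_kernel alpha beta gamma).
Proof.
(* Expanding the last square gives [- gamma] on both mixed terms and an extra [gamma] on both
   diagonal ones, which [alpha - gamma] and [beta - gamma] absorb. *)
pose m k (z w : R[i] * R[i]) := (k.+1%:R^-1)%:C * (
  (alpha - gamma)%:C * (z.1 ^+ k.+1 * (w.1 ^+ k.+1)^*)
  + (beta - gamma)%:C * (z.2 ^+ k.+1 * (w.2 ^+ k.+1)^*)
  + gamma%:C * ((z.1 ^+ k.+1 - z.2 ^+ k.+1) * (w.1 ^+ k.+1 - w.2 ^+ k.+1)^*)).
pose M n z w := \sum_(k < n) m k z w.
pose L u := - clog (1 - u) : R[i].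
(* [L] is minus the logarithm, so the coefficients are the exponents of the kernel with opposite
   sign. *)
pose Mlim (z w : R[i] * R[i]) :=
  alpha%:C * L (z.1 * w.1^*) + beta%:C * L (z.2 * w.2^*)
  + (- gamma)%:C * L (z.1 * w.2^*) + (- gamma)%:C * L (z.2 * w.1^*).
(* The assumptions on the parameters make the three weights nonnegative. *)
have sosM n : sos (M n).
  apply: (sos_sum (K := m)) => k.
  apply: sosZ; first by rewrite invr_ge0.
  apply: sosD; first apply: sosD.
  - apply: sosZ; first by rewrite subr_ge0 ltW.
    exact: (sos_square (fun z => z.1 ^+ k.+1)).
  - apply: sosZ; first by rewrite subr_ge0 ltW.
    exact: (sos_square (fun z => z.2 ^+ k.+1)).
  - apply: sosZ; first exact: ltW.
    exact: (sos_square (fun z => z.1 ^+ k.+1 - z.2 ^+ k.+1)).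
have disc u v : unit_disc u -> unit_disc v -> normc (u * v^*) < 1.
  rewrite /unit_disc /= => u1 v1; rewrite -ltcR -normr_normc normrM norm_conjC.
  by rewrite mulr_ilt1.
have McvgE n z w : M n z w =
    alpha%:C * log_partial (z.1 * w.1^*) n
    + beta%:C * log_partial (z.2 * w.2^*) n
    + (- gamma)%:C * log_partial (z.1 * w.2^*) n
    + (- gamma)%:C * log_partial (z.2 * w.1^*) n.
  rewrite /log_partial !mulr_sumr -!big_split; apply: eq_bigr => k _ /=.
  by rewrite /m !exprMn -!rmorphXn /= !(rmorphB, rmorphN) /=; ring.
have Mcvg z w : bidisc z -> bidisc w -> cconv (fun n => M n z w) (Mlim z w).
  move=> [z1 z2] [w1 w2]; under [X in cconv X]eq_fun do rewrite McvgE.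
  by do 3!(apply: cconvD; last by apply/cconvZ/log_partial_cvg/disc);
    apply/cconvZ/log_partial_cvg/disc.
(* Two successive pointwise limits: [n] grows for a fixed Taylor degree [l], where [M n] converges
   on the bidisc, and then [l] grows. *)
apply: (@nonneg_definite_lim _ _ _ (fun l z w => exp_partial (Mlim z w) l)).
  move=> l; apply: (@nonneg_definite_lim _ _ _
    (fun n z w => exp_partial (M n z w) l)).
    move=> n; apply: sos_nonneg_definite.
    apply: (@sos_sum _ _ (fun k z w => (k`!%:R^-1)%:C * M n z w ^+ k)) => k.
    by apply: sosZ; [rewrite invr_ge0|exact: sosX].
  move=> z w Oz Ow; apply: cconv_sum => k.
  by apply/cconvZ/cconvX/Mcvg.
(* Each power is [cexp] of a real multiple of [clog], so the exponents add by [cexpD] without any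
   question of branch. *)
move=> z w _ _; have -> : B_kernel alpha beta gamma z w = cexp (Mlim z w).
  rewrite /B_kernel /cpow /Mlim /L !cexpD.
  by do ![congr (_ * _)]; congr cexp; rewrite !rmorphN /=; ring.
exact: exp_partial_cvg.
Qed.
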